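(* In three spacetime dimensions, every higher-curvature theory with Lagrangian $\frac{2}{L^2}+R+\mathcal{G}(R,\mathcal{S}_2,\mathcal{S}_3)$, $\mathcal{G}$ polynomial, whose densities satisfy a simple holographic c-theorem has no scalar mode in its linearized spectrum around Einstein metrics $\bar R_{ab}=-\frac{2}{L_\star^2}\bar g_{ab}$. Equivalently, writing $\mathcal{G}=f(R)+\mathcal{S}_2g(R)+\mathcal{S}_2^2h(R,\mathcal{S}_2)+\mathcal{S}_3l(R,\mathcal{S}_2,\mathcal{S}_3)$, one has $12f''(R)+g(R)=0$ identically.
   Context: $R_{\langle ab\rangle}=R_{ab}-\frac13g_{ab}R$, $\mathcal{S}_2=R_{\langle a}{}^{b\rangle}R_{\langle b}{}^{a\rangle}$, $\mathcal{S}_3=R_{\langle a}{}^{b\rangle}R_{\langle b}{}^{c\rangle}R_{\langle c}{}^{a\rangle}$. An order-$n$ density is a linear combination of monomials $R^i\mathcal{S}_2^j\mathcal{S}_3^k$, $i+2j+3k=n$. A density satisfies a simple holographic c-theorem if its evaluation on $ds^2=dr^2+a(r)^2(-dt^2+dx^2)$ contains no derivatives of $a$ higher than the second and no powers of $a''$ higher than one; the requirement on $\mathcal{G}$ is imposed at each curvature order separately. On this metric $R|_a=-\frac{2(a'^2+2aa'')}{a^2}$, $\mathcal{S}_2|_a=\frac{2(a'^2-aa'')^2}{3a^4}$, $\mathcal{S}_3|_a=\frac{2(a'^2-aa'')^3}{9a^6}$. For a theory with $\mathcal{G}$ decomposed as in the claim, the squared mass of the scalar mode around the Einstein background is $m_s^2=\dfrac{1+f'(\bar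 R)+\frac{12}{L_\star^2}f''(\bar R)}{4f''(\bar R)+\frac13g(\bar R)}$, $\bar R=-6/L_\star^2$, and the scalar mode is absent when $m_s^2$ is infinite, i.e. $12f''(\bar R)+g(\bar R)=0$; for polynomial theories this is imposed order by order. *)

(* Defs.v *)
From HB Require Import structures.
From mathcomp Require Import all_boot all_order all_algebra.
From mathcomp Require Import mpoly.
From mathcomp Require Import boolp classical_sets reals ereal topology.
From mathcomp Require Import normedtype derive.
Set Implicit Arguments.
Unset Strict Implicit.
Unset Printing Implicit Defensive.
Import Order.TTheory GRing.Theory Num.Theory.
Import numFieldNormedType.Exports.
Local Open Scope ring_scope.

Section Curvature.
Variable R : realType.

(* A metric on R^3, given by its components in global coordinates. *)
Implicit Types (g : 'rV[R]_3 -> 'M[R]_3) (x : 'rV[R]_3).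

Definition partial (i : 'I_3) (F : 'rV[R]_3 -> R) x : R :=
  'D_(delta_mx 0 i) F x.

(* [christoffel g c a b] is Gamma^c_{ab}. *)
Definition christoffel g (c a b : 'I_3) x : R :=
  2^-1 * \sum_d invmx (g x) c d *
    (partial a (fun y => g y b d) x + partial b (fun y => g y a d) x
     - partial d (fun y => g y a b) x).

(* Sign convention: round spheres have positive Ricci curvature. *)
Definition ricci g x : 'M[R]_3 :=
  \matrix_(a, b) \sum_c
    (partial c (christoffel g c a b) x - partial b (christoffel g c a c) x
     + \sum_d (christoffel g c c d x * christoffel g d a b x
               - christoffel g c b d x * christoffel g d a c x)).

Definition scalar_curvature g x : R := \tr (invmx (g x) *m ricci g x).

Definition traceless_ricci g x : 'M[R]_3 :=
  ricci g x - (3^-1 * scalar_curvature g x) *: g x.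

(* Entry (a, b) is R_<a>^b, so that S_2 and S_3 are traces of its powers. *)
Definition mixed_traceless_ricci g x : 'M[R]_3 :=
  traceless_ricci g x *m invmx (g x).

Definition S2 g x : R :=
  let M := mixed_traceless_ricci g x in \tr (M *m M).

Definition S3 g x : R :=
  let M := mixed_traceless_ricci g x in \tr (M *m M *m M).

(* ds^2 = - a(r)^2 dt^2 + a(r)^2 dx^2 + dr^2 in the coordinates (t, x, r). *)
Definition domain_wall (a : R -> R) x : 'M[R]_3 :=
  let r := x 0 (inord 2) in
  diag_mx (\row_(i < 3) [:: - a r ^+ 2; a r ^+ 2; 1]`_i).

End Curvature.

(* A polynomial density: the variables 'X_0, 'X_1, 'X_2 stand for the
   invariants R, S_2, S_3. *)
Notation density R := {mpoly R[3]}.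

Section Theories.
Variable R : realType.
Implicit Types (D G : density R) (f g : {poly R}).

Definition ric_var : density R := 'X_(inord 0).
Definition S2_var : density R := 'X_(inord 1).
Definition S3_var : density R := 'X_(inord 2).

(* [mnmwgt] weighs the i-th variable by i.+1, so the weight of
   R^i S_2^j S_3^k is i + 2 j + 3 k, its curvature order. *)
Definition order_part (n : nat) G : density R := pihomog mnmwgt n G.

Definition eval_density D (g : 'rV[R]_3 -> 'M[R]_3) (x : 'rV[R]_3) : R :=
  D.@[tnth [tuple scalar_curvature g x; S2 g x; S3 g x]].

Definition smooth (a : R -> R) : Prop :=
  forall (n : nat) (r : R), derivable (derive1n n a) r 1.

(* The evaluated density is A(a, a') + B(a, a') a'': no derivative of [a]
   beyond the second occurs, and a'' occurs at most to the first power. *)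
Definition simple_c_theorem D : Prop :=
  exists A B : R -> R -> R,
  forall a : R -> R, smooth a -> (forall r, 0 < a r) ->
  forall x : 'rV[R]_3, let r := x 0 (inord 2) in
    eval_density D (domain_wall a) x =
      A (a r) (derive1 a r) + B (a r) (derive1 a r) * derive1n 2 a r.

Definition satisfies_c_theorem G : Prop :=
  forall n : nat, simple_c_theorem (order_part n G).

Definition lagrangian (L : R) G : density R :=
  (2 / L ^+ 2)%:MP + ric_var + G.

(* f(R) + S_2 g(R) + S_2^2 h(R, S_2) + S_3 l(R, S_2, S_3) *)
Definition decomposed f g (h : {mpoly R[2]}) (l : density R) : density R :=
  let in_ric (p : {poly R}) := (map_poly (@mpolyC 3 R) p).[ric_var] in
  in_ric f + S2_var * in_ric g
  + S2_var ^+ 2 * (h \mPo [tuple ric_var; S2_var]) + S3_var * l.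

(* The squared mass of the scalar mode around
   R_ab = - (2 / Lstar^2) g_ab; [+oo] encodes the (unsigned) infinite mass
   obtained when the denominator vanishes. *)
Definition scalar_mass_sq f g (Lstar : R) : \bar R :=
  let Rbar := - 6 / Lstar ^+ 2 in
  let num := 1 + f^`().[Rbar] + 12 / Lstar ^+ 2 * f^`(2).[Rbar] in
  let den := 4 * f^`(2).[Rbar] + 3^-1 * g.[Rbar] in
  if den == 0 then +oo%E else (num / den)%:E.

(* In the decomposition, f and g are determined by the Lagrangian up to the
   constant term of f, on which the mass does not depend. *)
Definition has_scalar_mass_sq (Lag : density R) (Lstar : R) (m2 : \bar R) :
    Prop :=
  exists (L : R) (f g : {poly R}) (h : {mpoly R[2]}) (l : density R),
    [/\ 0 < L, Lag = lagrangian L (decomposed f g h l)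
      & m2 = scalar_mass_sq f g Lstar].

Definition scalar_mode_absent (Lag : density R) (Lstar : R) : Prop :=
  has_scalar_mass_sq Lag Lstar +oo%E.

(* Absence of the scalar mode for a polynomial theory is imposed on each
   curvature order of G, as well as on the whole of G. *)
Definition no_scalar_mode (L : R) G (Lstar : R) : Prop :=
  scalar_mode_absent (lagrangian L G) Lstar /\
  forall n : nat, scalar_mode_absent (lagrangian L (order_part n G)) Lstar.

End Theories.

(* Main.v *)
Require Import Defs.
From mathcomp Require Import all_boot all_order all_algebra.
From mathcomp Require Import mpoly reals.
From mathcomp Require Import boolp classical_sets ereal topology.
From mathcomp Require Import normedtype derive.
From mathcomp Require Import ring lra.
Set Implicit Arguments.
Unset Strict Implicit.
Unset Printing Implicit Defensive.
Import Order.TTheory GRing.Theory Num.Theory.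
Import numFieldNormedType.Exports.
Local Open Scope ring_scope.

(* Test the c-theorem only at a point where a = a' = 1. With y = 1 - a'', the
   invariants there are R = 4 y - 6, S_2 = (2/3) y^2 and S_3 = (2/9) y^3, so a
   density f(R) + S_2 g(R) + S_2^2 h + S_3 l becomes a polynomial in y whose
   second derivative at 0 is (4/3) (12 f'' + g)(-6). A simple c-theorem makes
   this polynomial affine, because a'' can be chosen freely among infinitely
   many values; hence 12 f'' + g vanishes at -6. The polynomial 12 f'' + g of
   the order-n part of a density is the degree n - 2 term of that of the whole
   density, so that its vanishing at a single nonzero point, be it -6 or Rbar,
   for every n is equivalent to 12 f'' + g = 0. *)

(** * Diagonal inverses, polynomial identities and the test scale factors *)

Lemma invmx_diag (F : comUnitRingType) n (u v : 'rV[F]_n) :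
  (forall s, u 0 s * v 0 s = 1) -> invmx (diag_mx u) = diag_mx v.
Proof.
move=> uv1; have uv : diag_mx u *m diag_mx v = 1%:M.
  rewrite mulmx_diag -[RHS]diag_const_mx; congr diag_mx.
  by apply/rowP => s; rewrite !mxE uv1.
have [uU _] := mulmx1_unit uv.
by rewrite -[RHS]mul1mx -(mulVmx uU) -mulmxA uv mulmx1.
Qed.

Lemma big_ord3 (T : Type) (idx : T) (op : Monoid.law idx) (F : 'I_3 -> T) :
  \big[op/idx]_(i < 3) F i = op (F (inord 0)) (op (F (inord 1)) (F (inord 2))).
Proof.
rewrite !big_ord_recl big_ord0 Monoid.mulm1.
by congr (op (F _) (op (F _) (F _))); apply/val_inj; rewrite /= inordK.
Qed.

Lemma horner_mmap (R : comNzRingType) n (v : 'I_n -> {poly R})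
    (p : {mpoly R[n]}) (y : R) :
  (mmap (@polyC R) v p).[y] = p.@[fun i => (v i).[y]].
Proof.
rewrite /meval /mmap horner_sum; apply: eq_bigr => m _.
rewrite hornerM hornerC /mmap1 horner_prod; congr (_ * _).
by apply: eq_bigr => i _; rewrite horner_exp.
Qed.

Lemma poly_inj_roots_eq0 (R : idomainType) (p : {poly R}) (u : nat -> R) :
  injective u -> (forall k, p.[u k] = 0) -> p = 0.
Proof.
move=> u_inj pu0; apply/eqP/negPn/negP => p0.
have := max_poly_roots p0 (rs := [seq u k | k <- iota 0 (size p)]).
rewrite map_inj_uniq // iota_uniq size_map size_iota ltnn => lt.
suff /lt/(_ isT) : all (root p) [seq u k | k <- iota 0 (size p)] by [].
by apply/allP => _ /mapP[k _ ->]; apply/rootP.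
Qed.

(** The test scale factor: at r = 0 it has a = a' = 1 and a'' = 2 s, with s adjustable. *)
Lemma horner_quadratic (R : realFieldType) (s r : R) (p := 1 + 'X + s *: 'X^2) :
  [/\ p.[r] = 1 + r + s * r ^+ 2, p^`().[r] = 1 + 2 * s * r
    & p^`()^`().[r] = 2 * s].
Proof.
by split; rewrite /p ?poly.derivE !(hornerD, hornerZ, hornerMn, hornerX,
  hornerXn, hornerC) /=; ring.
Qed.

(** The discriminant 1 - 4 s is negative. Positivity on the whole line makes the quadratic an
    admissible scale factor. *)
Lemma quadratic_gt0 (R : realFieldType) (s r : R) :
  4^-1 < s -> 0 < (1 + 'X + s *: 'X^2).[r].
Proof.
move=> s_gt; have s0 : 0 < 4 * s by lra.
have [-> _ _] := horner_quadratic s r; rewrite -(pmulr_rgt0 _ s0).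
have -> : 4 * s * (1 + r + s * r ^+ 2) = (2 * s * r + 1) ^+ 2 + (4 * s - 1).
  by ring.
by rewrite ltr_wpDl ?sqr_ge0 //; lra.
Qed.

Lemma derive1_horner (R : realType) (p : {poly R}) :
  (horner p)^`()%classic = horner p^`().
Proof. by apply/funext => r; rewrite derive1E derive_val. Qed.

Lemma smooth_horner (R : realType) (p : {poly R}) : smooth (horner p).
Proof.
move=> n r; suff -> : derive1n n (horner p) = horner p^`(n).
  exact: derivable_horner.
elim: n => [|n IH]; first by rewrite derivn0.
by rewrite derive1nS IH derive1_horner derivnS.
Qed.

(** * Curvature of the domain-wall metric *)

Section DomainWall.
Variables (R : realType) (a a1 a2 : R -> R).
Hypothesis a_neq0 : forall r : R, a r != 0.
Hypothesis a_derive : forall r : R, is_derive r (1 : R) a (a1 r).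
Hypothesis a1_derive : forall r : R, is_derive r (1 : R) a1 (a2 r).
Implicit Types (i j k : 'I_3) (x : 'rV[R]_3).

Lemma partial_radial (phi : R -> R) k x :
  partial k (fun y => phi (y 0 (inord 2))) x =
  if val k == 2 then phi^`()%classic (x 0 (inord 2)) else 0.
Proof.
rewrite derive1E /partial; set r0 := x 0 (inord 2).
have dE (h : R) : (h *: (delta_mx 0 k : 'rV[R]_3) + x) 0 (inord 2) =
    (if val k == 2 then h else 0) + r0.
  rewrite !mxE /= -val_eqE /= inordK // eq_sym.
  by case: ifP => _; rewrite ?mulr1 ?mulr0.
case: ifP dE => _ dE.
  rewrite /derive /=; under eq_fun do rewrite dE.
  by under [in RHS]eq_fun do rewrite [_ *: 1]mulr1.
(* A displacement along t or x leaves r fixed. Writing 0 as the derivative of a constant turns both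
   sides into limits of vanishing difference quotients. *)
rewrite -(@derive_cst R _ _ (0 : R) x (delta_mx 0 k)) /derive /=.
under eq_fun do rewrite dE add0r subrr.
by under [in RHS]eq_fun do rewrite subrr.
Qed.

Lemma invmx_domain_wall x : let r := x 0 (inord 2) in
  invmx (domain_wall a x) =
  diag_mx (\row_(i < 3) [:: - a r ^- 2; a r ^- 2; 1]`_i).
Proof.
move=> r; apply: invmx_diag => i; rewrite !mxE.
by case: i => [[|[|[|]]] //= _]; rewrite -/r; field; rewrite ?a_neq0.
Qed.

Lemma partial_domain_wall k i j x : let r := x 0 (inord 2) in
  partial k (fun y => domain_wall a y i j) x =
  if [&& val k == 2 & i == j]
  then [:: - 2 * a r * a1 r; 2 * a r * a1 r; 0]`_i else 0.
Proof.
move=> r; pose phi s := [:: - a s ^+ 2; a s ^+ 2; 1]`_i *+ (i == j).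
have -> : (fun y => domain_wall a y i j) = fun y => phi (y 0 (inord 2)).
  by apply/funext => y; rewrite !mxE.
rewrite partial_radial derive1E; case: eqP => //= _; rewrite /phi -/r {phi}.
have da := a_derive r.
have da2 : 'D_1 (fun s => a s ^+ 2) r = 2 * a r * a1 r.
  by rewrite derive_val /GRing.scale/=; ring.
have daN : 'D_1 (fun s => - a s ^+ 2) r = - 2 * a r * a1 r.
  by rewrite derive_val /GRing.scale/=; ring.
case: eqP => _; last exact: derive_cst.
by case: i => [[|[|[|]]] //= _];
  first [exact: da2 | exact: daN | exact: derive_cst].
Qed.

(** The Christoffel symbols with upper index [k], where 0, 1, 2 stand for t, x, r; the two signs of
    a a' reflect the Lorentzian signature. *)
Definition wall_connection k i j r : R :=
  match val k, val i, val j with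
  | 0, 0, 2 | 0, 2, 0 | 1, 1, 2 | 1, 2, 1 => a1 r / a r
  | 2, 0, 0 => a r * a1 r
  | 2, 1, 1 => - (a r * a1 r)
  | _, _, _ => 0
  end.

Lemma christoffel_domain_wall k i j x :
  christoffel (domain_wall a) k i j x =
  wall_connection k i j (x 0 (inord 2)).
Proof.
rewrite /christoffel invmx_domain_wall /wall_connection.
under eq_bigr do rewrite !partial_domain_wall !mxE.
rewrite !big_ord_recl big_ord0.
have := a_neq0 (x 0 (inord 2)); move: (a _) (a1 _) => u v u0.
by case: i j k => [[|[|[|]]] //= ?] [[|[|[|]]] //= ?] [[|[|[|]]] //= ?];
  rewrite -?val_eqE /= ?mulr0n ?mulr1n; field.
Qed.

(** The r-derivatives of the entries of [wall_connection]. *)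
Definition wall_dconnection k i j r : R :=
  match val k, val i, val j with
  | 0, 0, 2 | 0, 2, 0 | 1, 1, 2 | 1, 2, 1 => a2 r / a r - (a1 r / a r) ^+ 2
  | 2, 0, 0 => a1 r ^+ 2 + a r * a2 r
  | 2, 1, 1 => - (a1 r ^+ 2 + a r * a2 r)
  | _, _, _ => 0
  end.

Lemma partial_christoffel_domain_wall l k i j x :
  partial l (christoffel (domain_wall a) k i j) x =
  if val l == 2 then wall_dconnection k i j (x 0 (inord 2)) else 0.
Proof.
have -> : christoffel (domain_wall a) k i j =
    fun y => wall_connection k i j (y 0 (inord 2)).
  by apply/funext => y; exact: christoffel_domain_wall.
rewrite partial_radial derive1E; case: ifP => // _; set r := x 0 _.
have da := a_derive r; have da1 := a1_derive r; have a0 := a_neq0 r.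
have dq : 'D_1 (fun s => a1 s / a s) r = a2 r / a r - (a1 r / a r) ^+ 2.
  rewrite deriveM; [|exact: ex_derive|by apply: derivableV].
  by rewrite deriveV // !derive_val /GRing.scale/=; field.
have dm : 'D_1 (fun s => a s * a1 s) r = a1 r ^+ 2 + a r * a2 r.
  by rewrite derive_val /GRing.scale/=; ring.
have dN : 'D_1 (fun s => - (a s * a1 s)) r = - (a1 r ^+ 2 + a r * a2 r).
  by rewrite derive_val /GRing.scale/=; ring.
rewrite /wall_connection /wall_dconnection.
by case: i j k => [[|[|[|]]] //= ?] [[|[|[|]]] //= ?] [[|[|[|]]] //= ?];
  first [exact: dq | exact: dm | exact: dN | exact: derive_cst].
Qed.

Lemma ricci_domain_wall x : let r := x 0 (inord 2) in
  ricci (domain_wall a) x =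
  diag_mx (\row_(i < 3) [:: a r * a2 r + a1 r ^+ 2;
                            - (a r * a2 r + a1 r ^+ 2);
                            - (2 * a2 r / a r)]`_i).
Proof.
move=> r; apply/matrixP => i j; rewrite !mxE.
under eq_bigr do rewrite !partial_christoffel_domain_wall.
under eq_bigr => k _ do under eq_bigr do rewrite !christoffel_domain_wall.
rewrite !big_ord_recl !big_ord0 -/r /wall_connection /wall_dconnection.
have := a_neq0 r; move: (a r) (a1 r) (a2 r) => u v w u0.
by case: i j => [[|[|[|]]] //= ?] [[|[|[|]]] //= ?];
  rewrite -?val_eqE /= ?mulr0n ?mulr1n; field.
Qed.

Lemma scalar_curvature_domain_wall x : let r := x 0 (inord 2) in
  scalar_curvature (domain_wall a) x =
  - (2 * (a1 r ^+ 2 + 2 * a r * a2 r) / a r ^+ 2).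
Proof.
move=> r; rewrite /scalar_curvature ricci_domain_wall invmx_domain_wall -/r.
rewrite mulmx_diag mxtrace_diag !big_ord_recl big_ord0 !mxE /=.
by field; exact: a_neq0.
Qed.

(** The t and x directions share one eigenvalue and the trace vanishes, so a single function s
    remains; S_2 and S_3 are then multiples of its square and cube. *)
Lemma mixed_traceless_ricci_domain_wall x : let r := x 0 (inord 2) in
  let s := (a r * a2 r - a1 r ^+ 2) / a r ^+ 2 in
  mixed_traceless_ricci (domain_wall a) x =
  diag_mx (\row_(i < 3) [:: s / 3; s / 3; - (2 * s / 3)]`_i).
Proof.
move=> r s; rewrite /mixed_traceless_ricci /traceless_ricci.
rewrite scalar_curvature_domain_wall ricci_domain_wall invmx_domain_wall -/r.
rewrite /domain_wall -/r -linearZ -linearB mulmx_diag /=; congr diag_mx.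
rewrite /s; apply/rowP => i; rewrite !mxE.
by case: i => [[|[|[|]]] //= _]; field; exact: a_neq0.
Qed.

Lemma S2_domain_wall x : let r := x 0 (inord 2) in
  S2 (domain_wall a) x =
  2 * (a1 r ^+ 2 - a r * a2 r) ^+ 2 / (3 * a r ^+ 4).
Proof.
move=> r; rewrite /S2 mixed_traceless_ricci_domain_wall mulmx_diag mxtrace_diag.
rewrite !big_ord_recl big_ord0 !mxE /= -/r.
by field; exact: a_neq0.
Qed.

Lemma S3_domain_wall x : let r := x 0 (inord 2) in
  S3 (domain_wall a) x =
  2 * (a1 r ^+ 2 - a r * a2 r) ^+ 3 / (9 * a r ^+ 6).
Proof.
move=> r; rewrite /S3 mixed_traceless_ricci_domain_wall !mulmx_diag.
rewrite mxtrace_diag !big_ord_recl big_ord0 !mxE /= -/r.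
by field; exact: a_neq0.
Qed.

End DomainWall.

(** * Existence and uniqueness of the decomposition, and its curvature orders *)

Section Decomposition.
Variable R : realType.
Implicit Types (D G l : density R) (f g : {poly R}) (h : {mpoly R[2]}).

Lemma mmap_in_ric (S : comNzRingType) (phi : {rmorphism R -> S})
    (v : 'I_3 -> S) f :
  mmap phi v (map_poly (@mpolyC 3 R) f).[ric_var R] =
  (map_poly phi f).[v (inord 0)].
Proof.
rewrite -horner_map -map_poly_comp; congr _.[_].
  by apply: eq_map_poly => c /=; rewrite mmapC.
by rewrite /ric_var /= mmapX mmap1U.
Qed.

(** The image of [h] is hidden in [c]: later only its factor, the square of the image of S_2,
    matters. *)
Lemma mmap_decomposed (S : comNzRingType) (phi : {rmorphism R -> S})
    (v : 'I_3 -> S) f g h l :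
  exists c, mmap phi v (decomposed f g h l) =
    (map_poly phi f).[v (inord 0)]
    + v (inord 1) * (map_poly phi g).[v (inord 0)]
    + v (inord 1) ^+ 2 * c + v (inord 2) * mmap phi v l.
Proof.
exists (mmap phi v (h \mPo [tuple ric_var R; S2_var R])).
rewrite /decomposed !mmapD !(rmorphM (mmap phi v)) /=.
by rewrite !mmap_in_ric /S2_var /S3_var !mmapX !mmap1U.
Qed.

(* Setting S_3 = 0 and reading [D] as a polynomial in S_2 over {poly R}
   recovers f and g as the coefficients of degrees 0 and 1. *)
Definition in_S2 D : {poly {poly R}} :=
  mmap (@polyC {poly R} \o @polyC R)
    (fun i : 'I_3 => [:: 'X%:P; 'X; 0]`_i) D.

Lemma in_S2_decomposed f g h l :
  (in_S2 (decomposed f g h l))`_0 = f /\ (in_S2 (decomposed f g h l))`_1 = g.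
Proof.
rewrite /in_S2.
have [c ->] := mmap_decomposed (@polyC {poly R} \o @polyC R)
  (fun i : 'I_3 => [:: 'X%:P; 'X; 0]`_i) f g h l.
rewrite !inordK //= mul0r addr0.
(* Since R is sent to the inner variable, [f] and [g] become constants in S_2, while the [h] term
   starts at degree 2. *)
have E p : (map_poly (@polyC {poly R} \o @polyC R) p).['X%:P] = p%:P.
  by rewrite map_poly_comp horner_map /= -[in RHS](comp_polyXr p).
by rewrite !E !coefD !coefXM !coefXnM !coefC /= !addr0 ?add0r.
Qed.

Lemma decomposed_linear (c : R) f g h l f' g' h' l' :
  c *: decomposed f g h l + decomposed f' g' h' l' =
  decomposed (c *: f + f') (c *: g + g') (c *: h + h') (c *: l + l').
Proof.
have E p q : (map_poly (@mpolyC 3 R) (c *: p + q)).[ric_var R] =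
   c *: (map_poly (@mpolyC 3 R) p).[ric_var R]
    + (map_poly (@mpolyC 3 R) q).[ric_var R].
  by rewrite rmorphD /= map_polyZ hornerD hornerZ mul_mpolyC.
rewrite /decomposed !E linearP /= !scalerDr !mulrDr !scalerAr; ring.
Qed.

Lemma monomialE (m : 'X_{1..3}) : 'X_[m] =
  ric_var R ^+ m (inord 0) * S2_var R ^+ m (inord 1) * S3_var R ^+ m (inord 2).
Proof. by rewrite mpolyXE_id big_ord3 /= mulrA. Qed.

Lemma mnmwgt3 (m : 'X_{1..3}) :
  mnmwgt m = (m (inord 0) + 2 * m (inord 1) + 3 * m (inord 2))%N.
Proof.
rewrite /mnmwgt big_ord3 !inordK //=.
by rewrite muln1 addnA ![(_ * m _)%N]mulnC.
Qed.

(** A monomial fits into a single slot: [l] if S_3 divides it, otherwise [f], [g] or [h] according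
    to whether the exponent of S_2 is 0, 1 or at least 2. *)
Lemma decomposedX (m : 'X_{1..3}) : exists f g h l,
  'X_[m] = decomposed f g h l :> density R.
Proof.
rewrite (monomialE m); move: (m (inord 0)) (m (inord 1)) (m (inord 2)).
move=> i j [|k]; last first.
  exists 0, 0, 0, (ric_var R ^+ i * S2_var R ^+ j * S3_var R ^+ k).
  by rewrite /decomposed !rmorph0 /= horner0 !mulr0 !add0r exprS mulrCA.
rewrite expr0 mulr1; case: j => [|[|j]].
- exists ('X^i), 0, 0, 0; rewrite /decomposed !rmorph0 /= horner0 !mulr0 !addr0.
  by rewrite map_polyXn hornerXn mulr1.
- exists 0, ('X^i), 0, 0; rewrite /decomposed !rmorph0 /= horner0 !mulr0 !addr0.
  by rewrite map_polyXn hornerXn add0r mulrC.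
- exists 0, 0, ('X_(inord 0) ^+ i * 'X_(inord 1) ^+ j), 0.
  rewrite /decomposed !rmorph0 /= horner0 !mulr0 add0r addr0.
  rewrite rmorphM !rmorphXn /= !comp_mpolyXU /= !inordK //= add0r.
  by rewrite [RHS]mulrCA -exprD.
Qed.

Lemma decomposition_exists D : exists f g h l, D = decomposed f g h l.
Proof.
elim/mpolyind: D => [|c m p _ _ [f' [g' [h' [l' ->]]]]].
  exists 0, 0, 0, 0; rewrite /decomposed !rmorph0 horner0.
  by rewrite /= !mulr0 !addr0.
have [f [g [h [l ->]]]] := decomposedX m.
by rewrite decomposed_linear; eexists _, _, _, _.
Qed.

Lemma coef_in_S2X (m : 'X_{1..3}) i j :
  (in_S2 'X_[m])`_j`_i =
  [&& i == m (inord 0), j == m (inord 1) & m (inord 2) == 0%N]%:R.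
Proof.
rewrite /in_S2 mmapX /mmap1 big_ord3 !inordK //=.
case: (m (inord 2)) => [|k]; last by rewrite expr0n !mulr0 !coef0 !andbF.
rewrite expr0 mulr1 -rmorphXn coefCM coefXn eqxx andbT.
by case: eqP => _; rewrite ?mulr1 ?mulr0 ?coefXn ?coef0 ?andbT ?andbF.
Qed.

Lemma coef_in_S2_linear (c : R) D G i j :
  (in_S2 (c *: D + G))`_j`_i = c * (in_S2 D)`_j`_i + (in_S2 G)`_j`_i.
Proof. by rewrite /in_S2 mmapD mmapZ !coefD !coefCM. Qed.

(** This coefficient belongs to R^i S_2^j, of order i + 2 j; projecting to order n either keeps or
    kills it. *)
Lemma in_S2_order_part n D i j :
  (in_S2 (order_part n D))`_j`_i =
  if (i + 2 * j == n)%N then (in_S2 D)`_j`_i else 0.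
Proof.
have in_S20 u v : (in_S2 0)`_u`_v = 0 by rewrite /in_S2 mmap0 !coef0.
rewrite /order_part; elim/mpolyind: D => [|c m p _ _ IH].
  by rewrite pihomog0 in_S20 if_same.
rewrite linearP !coef_in_S2_linear IH /= pihomogX /= mnmwgt3 coef_in_S2X.
have [/and3P[/eqP-> /eqP-> /eqP m2]|ijm] := boolP [&& _, _ & _].
  by rewrite m2 muln0 addn0; case: ifP;
    rewrite ?coef_in_S2X ?in_S20 ?m2 ?eqxx // mulr0 add0r.
have -> : (in_S2 (if (m (inord 0) + 2 * m (inord 1) + 3 * m (inord 2) == n)%N
    then 'X_[m] else 0))`_j`_i = 0.
  by case: ifP => _; rewrite ?coef_in_S2X ?(negbTE ijm).
by rewrite mulr0 !add0r.
Qed.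

End Decomposition.

(** * Consequence of the c-theorem at one point of the test metrics *)

Section CTheorem.
Variable R : realType.
Implicit Types (D l : density R) (f g : {poly R}) (h : {mpoly R[2]}).

(* The density at a point where a = a' = 1, as a polynomial in y = 1 - a''. *)
Definition wall_poly D : {poly R} :=
  mmap (@polyC R)
    (tnth [tuple 4 *: 'X - 6%:P; (2 / 3) *: 'X^2; (2 / 9) *: 'X^3]) D.

Lemma eval_density_wall D (s : R) : 4^-1 < s ->
  eval_density D (domain_wall (horner (1 + 'X + s *: 'X^2))) 0 =
  (wall_poly D).[1 - 2 * s].
Proof.
move=> s_gt; set p : {poly R} := _ + _.
have p_gt0 r : 0 < p.[r] by exact: quadratic_gt0.
rewrite /wall_poly horner_mmap /eval_density.
have p_neq0 r : p.[r] != 0 by rewrite gt_eqF.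
have dp r := is_derive_poly p r; have ddp r := is_derive_poly p^`() r.
rewrite (scalar_curvature_domain_wall p_neq0 dp ddp).
rewrite (S2_domain_wall p_neq0 dp ddp) (S3_domain_wall p_neq0 dp ddp).
have -> : (0 : 'rV[R]_3) 0 (inord 2) = 0 by rewrite mxE.
have [-> -> ->] := horner_quadratic s 0; rewrite expr0n !mulr0 !addr0.
rewrite /meval; congr (mmap _ _ _); apply/funext => i.
by case: i => [[|[|[|]]] //= ?]; rewrite /tnth /=
  !(hornerD, hornerN, hornerZ, hornerX, hornerXn, hornerC); field.
Qed.

(** The [f] term f(4 y - 6) contributes 16 f''(-6) and the [g] term (4/3) g(-6); the [h] and [l]
    terms are divisible by y^4 and y^3. *)
Lemma derivn2_wall_poly f g h l :
  (wall_poly (decomposed f g h l))^`(2).[0] =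
  4 / 3 * (12 *: f^`(2) + g).[- 6].
Proof.
rewrite /wall_poly; set v := tnth _.
have [c ->] := mmap_decomposed (@polyC R) v f g h l.
rewrite /v !(tnth_nth 0) /= !inordK //= -!/(_ \Po _).
move: (mmap _ _ l) => {}l.
rewrite !(poly.derivE, deriv_comp).
rewrite !(hornerD, hornerN, hornerM, hornerZ, hornerMn, hornerX, hornerXn,
  hornerC, horner_exp, horner_comp, horner0) /= ?mulr0 ?sub0r.
by field.
Qed.

Lemma simple_c_theorem_root f g h l :
  simple_c_theorem (decomposed f g h l) -> (12 *: f^`(2) + g).[- 6] = 0.
Proof.
move=> [A [B cAB]].
(* The c-theorem at a = a' = 1 predicts A(1, 1) + B(1, 1) a'', with a'' = 1 - y. *)
pose q := wall_poly (decomposed f g h l) - (A 1 1)%:P - B 1 1 *: (1 - 'X).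
have q0 : q = 0.
  (* Sample s = k + 1, that is a'' = 2 (k + 1); starting at s = 1 keeps every scale factor
     positive. *)
  apply: (@poly_inj_roots_eq0 _ _ (fun k => 1 - 2 * k.+1%:R)) => [i j /eqP|k].
    rewrite (inj_eq (addrI _)) eqr_opp (inj_eq (mulfI _)) ?pnatr_eq0 //.
    by rewrite eqr_nat => /eqP[].
  set s : R := k.+1%:R; set p : {poly R} := 1 + 'X + s *: 'X^2.
  have s1 : 1 <= s by rewrite ler1n.
  have p_gt0 r : 0 < p.[r] by apply: quadratic_gt0; lra.
  have := cAB _ (@smooth_horner _ p) p_gt0 0.
  rewrite /p eval_density_wall; last by lra.
  rewrite -/p mxE derive1nS derive1n1 !derive1_horner.
  have [-> -> ->] := horner_quadratic s 0.
  rewrite expr0n !mulr0 !addr0.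
  by rewrite /q !(hornerD, hornerN, hornerZ, hornerX, hornerC) => ->; ring.
have := derivn2_wall_poly f g h l.
have -> : (wall_poly (decomposed f g h l))^`(2) = 0.
  have -> : wall_poly (decomposed f g h l) = (A 1 1)%:P + B 1 1 *: (1 - 'X).
    by apply/eqP; rewrite -subr_eq0 opprD addrA; apply/eqP.
  by rewrite !derivnS !derivn0 !poly.derivE subrr scaler0 addr0.
rewrite horner0; lra.
Qed.

End CTheorem.

(** * Scalar mass, order by order, and the identity 12 f'' + g = 0 *)

Section ScalarMode.
Variable R : realType.
Implicit Types (D G l : density R) (f g : {poly R}) (h : {mpoly R[2]}).

(** The denominator of the mass is one third of 12 f'' + g, and a nonzero denominator gives a finite
    value. *)
Lemma scalar_mass_sq_infinite f g (Lstar : R) :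
  scalar_mass_sq f g Lstar = +oo%E <->
  (12 *: f^`(2) + g).[- 6 / Lstar ^+ 2] = 0.
Proof.
rewrite /scalar_mass_sq hornerD hornerZ; set u := f^`(2).[_]; set v := g.[_].
split; first by case: eqP => // ? _; lra.
by move=> uv; rewrite ifT //; apply/eqP; lra.
Qed.

Lemma decomposed_inj f g h l f' g' h' l' :
  decomposed f g h l = decomposed f' g' h' l' -> f = f' /\ g = g'.
Proof.
move=> E; have [f0 g0] := in_S2_decomposed f g h l.
have [f'0 g'0] := in_S2_decomposed f' g' h' l'.
by move: f0 g0; rewrite E f'0 g'0 => -> ->.
Qed.

Lemma decomposedC (c : R) f g h l :
  c%:MP + decomposed f g h l = decomposed (c%:P + f) g h l.
Proof.
by rewrite /decomposed rmorphD /= map_polyC /= hornerD hornerC !addrA.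
Qed.

Lemma scalar_mode_absentE (L Lstar : R) f g h l : 0 < L ->
  scalar_mode_absent (lagrangian L (decomposed f g h l)) Lstar <->
  (12 *: f^`(2) + g).[- 6 / Lstar ^+ 2] = 0.
Proof.
move=> L_gt0; split=> [[L' [f' [g' [h' [l' [_]]]]]]|fg0]; last first.
  by exists L, f, g, h, l; split=> //; apply/esym/scalar_mass_sq_infinite.
(* The two Lagrangians may split the constant differently between 2 / L^2 and [f]. Absorbing it into
   [f] allows uniqueness to apply, and f'' does not see it. *)
rewrite /lagrangian addrAC [RHS]addrAC => /addIr.
rewrite !decomposedC => /decomposed_inj[/(congr1 (derivn 2)) fE <-].
move/esym/scalar_mass_sq_infinite.
by move: fE; rewrite !derivnS !derivn0 !derivD !derivC !add0r => ->.
Qed.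

Lemma coef_mass_poly f g h l i :
  (12 *: f^`(2) + g)`_i =
  12 * ((in_S2 (decomposed f g h l))`_0`_(i.+2) *+ (i.+2 * i.+1))
  + (in_S2 (decomposed f g h l))`_1`_i.
Proof.
have [-> ->] := in_S2_decomposed f g h l.
rewrite coefD coefZ coef_derivn; congr (_ * _ + _).
by rewrite addnC !ffactnS ffactn0 muln1 addn2.
Qed.

(** Degree i of 12 f'' + g comes from R^(i + 2) and S_2 R^i, both of curvature order i + 2. *)
Lemma mass_poly_order_part n f g h l f' g' h' l' :
  order_part n (decomposed f g h l) = decomposed f' g' h' l' ->
  forall i, (12 *: f'^`(2) + g')`_i =
    if (i + 2 == n)%N then (12 *: f^`(2) + g)`_i else 0.
Proof.
move=> E i; rewrite (coef_mass_poly f' g' h' l') (coef_mass_poly f g h l) -E.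
rewrite !in_S2_order_part muln0 muln1 addn0 !addn2.
by case: ifP => _ //; rewrite mul0rn mulr0 addr0.
Qed.

(** At order i + 2 only the degree i monomial survives, and a nonzero root kills its coefficient.
    The root [z] is kept general to serve both - 6 and the background curvature. *)
Lemma mass_poly_eq0 f g h l (z : R) : z != 0 ->
  (forall n f' g' h' l',
     order_part n (decomposed f g h l) = decomposed f' g' h' l' ->
     (12 *: f'^`(2) + g').[z] = 0) ->
  12 *: f^`(2) + g = 0.
Proof.
move=> z0 root_z; apply/polyP => i; rewrite coef0.
have [f' [g' [h' [l' E]]]] :=
  decomposition_exists (order_part (i + 2) (decomposed f g h l)).
have := root_z _ _ _ _ _ E; have := mass_poly_order_part E.
move: (12 *: f'^`(2) + g') (12 *: f^`(2) + g) => p q pq.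
have -> : p = q`_i *: 'X^i.
  apply/polyP => j; rewrite pq coefZ coefXn eqn_add2r.
  by case: eqP => [->|_]; rewrite ?mulr1 ?mulr0.
rewrite hornerZ hornerXn => /eqP.
by rewrite mulf_eq0 expf_eq0 (negbTE z0) andbF orbF => /eqP.
Qed.

Lemma no_scalar_modeE (L Lstar : R) f g h l : 0 < L -> 0 < Lstar ->
  no_scalar_mode L (decomposed f g h l) Lstar <-> 12 *: f^`(2) + g = 0.
Proof.
move=> L_gt0 Lstar_gt0; split=> [[_ ord]|fg0].
  apply: (@mass_poly_eq0 _ _ h l (- 6 / Lstar ^+ 2)).
    by rewrite mulf_neq0 ?invr_eq0 ?expf_neq0 ?oppr_eq0 ?pnatr_eq0 ?gt_eqF.
  move=> n f' g' h' l' E.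
  by apply/(scalar_mode_absentE _ _ _ h' l' L_gt0); rewrite -E.
split=> [|n]; first by apply/scalar_mode_absentE; rewrite // fg0 horner0.
have [f' [g' [h' [l' E]]]] :=
  decomposition_exists (order_part n (decomposed f g h l)).
rewrite E; apply/scalar_mode_absentE => //.
suff -> : 12 *: f'^`(2) + g' = 0 by rewrite horner0.
by apply/polyP => i; rewrite (mass_poly_order_part E) fg0 coef0 if_same.
Qed.

End ScalarMode.

Theorem mainTheorem13 (R : realType) (L Lstar : R) (L_gt0 : 0 < L)
    (Lstar_gt0 : 0 < Lstar) (G : {mpoly R[3]}) :
  (satisfies_c_theorem G -> no_scalar_mode L G Lstar) /\
  (forall (f g : {poly R}) (h : {mpoly R[2]}) (l : {mpoly R[3]}),
     G = decomposed f g h l ->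
     (no_scalar_mode L G Lstar <-> 12 *: f^`(2) + g = 0)).
Proof.
split=> [cG|f g h l ->]; last exact: no_scalar_modeE.
have [f [g [h [l GE]]]] := decomposition_exists G; subst G.
(* The c-theorem gives the root - 6 rather than the background curvature; the polynomial identity
   bridges the two. *)
apply/no_scalar_modeE => //; apply: (@mass_poly_eq0 _ _ _ h l (- 6)).
  by rewrite oppr_eq0 pnatr_eq0.
move=> n f' g' h' l' E; apply: (@simple_c_theorem_root _ _ _ h' l').
by rewrite -E; exact: cG.
Qed.
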